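(* Let $E$ be a closed subset of $[0,1]$ with $0\in E$, set $\Delta=\{(a,b)\in[0,1]^2: a,b\in E,\ a<b,\ (a,b)\cap E=\emptyset\}$, and let $(\sigma_{a,b})_{(a,b)\in\Delta}\in\{1,\infty\}^\Delta$. Then there exists a convex algebra $\langle[0,1],\oplus_p\rangle$ that satisfies (MO), (UC), (LC), such that $E^\oplus=E$ (hence $\Delta^\oplus=\Delta$) and $\tau^\oplus_{a,b}=\sigma_{a,b}$ for all $(a,b)\in\Delta$.
   Context: A convex algebra $\langle X,\oplus_p\rangle$ is a set $X$ with binary operations $\oplus_p$, $p\in(0,1)$, satisfying, for all $x,y,z\in X$ and $p,q\in(0,1)$: $x\oplus_p x=x$; $x\oplus_p y=y\oplus_{1-p}x$; and $(x\oplus_p y)\oplus_q z=x\oplus_{pq}\big(y\oplus_{\frac{(1-p)q}{1-pq}}z\big)$. For a convex subset $X\subseteq\mathbb R$, $x+_p y=px+(1-p)y$. On $[0,1]$, order and topology are the usual ones. Conditions on a convex algebra $\langle[0,1],\oplus_p\rangle$: (MO): for all $x,x',y\in[0,1]$, $p\in(0,1)$, $x\le x'$ implies $x\oplus_p y\le x'\oplus_p y$. (UC): for all $x,y\in[0,1)$, $p\in(0,1)$, $\limsup_{\varepsilon\to0+}[(x+\varepsilon)\oplus_p(y+\varepsilon)]\le x\oplus_p y$. (LC): for all $x\le y$ in $[0,1]$, $\liminf_{p\to1-}[y\oplus_p x]\ge y$. Write $y\triangleright x$ if $y\oplus_t x=y$ for all $t\in(0,1]$. $E^\oplus=\{y\in[0,1]:y\triangleright0\}$,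 $\Delta^\oplus=\{(a,b): a,b\in E^\oplus, a<b, (a,b)\cap E^\oplus=\emptyset\}$. For an algebra satisfying (MO),(UC),(LC) and $(a,b)\in\Delta^\oplus$, $\tau^\oplus_{a,b}$ denotes the unique $\tau\in\{1,\infty\}$ such that the subalgebra $\langle[a,b),\oplus_p\rangle$ is isomorphic to $\langle[0,\tau),+_p\rangle$. *)

(* Defs.v *)
From mathcomp Require Import all_boot all_order all_algebra.
From mathcomp Require Import all_classical all_reals all_analysis.
Import Order.TTheory GRing.Theory Num.Theory.
Import numFieldNormedType.Exports.

Set Implicit Arguments.
Unset Strict Implicit.
Unset Printing Implicit Defensive.

Local Open Scope classical_set_scope.
Local Open Scope ring_scope.

(* A family of binary operations is a function [op : R -> T -> T -> T], where
   [op p x y] stands for x (+)_p y.  It is only meaningful for 0 < p < 1 and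
   x, y in the carrier, a set [X]; its other values are irrelevant.  The
   library's [convType] puts the operations on a whole type and indexes them by
   the closed unit interval, hence these set-based versions with p in (0, 1). *)

Definition conv_closed (R : realType) (T : Type) (X : set T)
    (op : R -> T -> T -> T) : Prop :=
  forall (p : R) x y, 0 < p < 1 -> X x -> X y -> X (op p x y).

Record convex_algebra (R : realType) (T : Type) (X : set T)
    (op : R -> T -> T -> T) : Prop := ConvexAlgebra {
  ca_closed : conv_closed X op;
  ca_idem : forall (p : R) x, 0 < p < 1 -> X x -> op p x x = x;
  ca_comm : forall (p : R) x y, 0 < p < 1 -> X x -> X y ->
    op p x y = op (1 - p) y x;
  ca_assoc : forall (p q : R) x y z, 0 < p < 1 -> 0 < q < 1 -> X x -> X y -> X z ->
    op q (op p x y) z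
    = op (p * q) x (op ((1 - p) * q / (1 - p * q)) y z)
}.

Definition subalgebra (R : realType) (T : Type) (X Y : set T)
    (op : R -> T -> T -> T) : Prop :=
  Y `<=` X /\ conv_closed Y op.

Definition conv_isomorphic (R : realType) (T U : Type)
    (X : set T) (opX : R -> T -> T -> T)
    (Y : set U) (opY : R -> U -> U -> U) : Prop :=
  exists f : T -> U, set_bij X Y f /\
    forall (p : R) x y, 0 < p < 1 -> X x -> X y ->
      f (opX p x y) = opY p (f x) (f y).

Definition real_conv (R : realType) (p x y : R) : R := p * x + (1 - p) * y.

Section conditions.
Variables (R : realType) (op : R -> R -> R -> R).

Definition MO : Prop := forall x x' y p : R,
  `[0, 1]%classic x -> `[0, 1]%classic x' -> `[0, 1]%classic y -> 0 < p < 1 ->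
  x <= x' -> op p x y <= op p x' y.

Definition UC : Prop := forall x y p : R,
  `[0, 1[%classic x -> `[0, 1[%classic y -> 0 < p < 1 ->
  (limf_esup (fun e : R => (op p (x + e) (y + e))%:E) (0 : R)^'+
     <= (op p x y)%:E)%E.

Definition LC : Prop := forall x y : R,
  `[0, 1]%classic x -> `[0, 1]%classic y -> x <= y ->
  (y%:E <= limf_einf (fun p : R => (op p y x)%:E) (1 : R)^'-)%E.

(* The parameter t = 1 is left out: by convention, y (+)_1 x is y. *)
Definition dominates (y x : R) : Prop := forall t : R, 0 < t < 1 -> op t y x = y.

Definition Eset : set R := [set y | `[0, 1]%classic y /\ dominates y 0].

(* [0, t), where t may be +oo *)
Definition ico0 (t : \bar R) : set R := [set x : R | 0 <= x /\ (x%:E < t)%E].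

Definition tau_candidate (a b : R) (t : \bar R) : Prop :=
  (t = 1%E \/ t = +oo%E) /\
  subalgebra `[0, 1]%classic `[a, b[%classic op /\
  conv_isomorphic `[a, b[%classic op (ico0 t) (@real_conv R).

Definition is_tau (a b : R) (t : \bar R) : Prop :=
  unique (tau_candidate a b) t.

End conditions.

Definition gaps (R : realType) (E : set R) : set (R * R) :=
  [set ab : R * R | [/\ E ab.1, E ab.2, ab.1 < ab.2 &
                        `]ab.1, ab.2[%classic `&` E = set0]].

(* Main.v *)
(* The carrier [0, 1] splits into blocks, one for each a in E: the block of a is
   the set of x with max(E /\ [0, x]) = a.  An increasing rational coordinate
   sending a to 0 identifies the block with {0}, [0, 1), [0, +oo) or, for the
   block reaching up to 1, with [0, 1]; it thereby becomes a convex algebra.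
   The blocks form a chain, and [op] is their Plonka sum: to combine points of
   two blocks, replace the lower one by the zero a of the higher block.  The
   code (a, coordinate) of a point is increasing for the lexicographic order,
   which gives (MO); (UC) and (LC) follow from the continuity of the coordinates
   and of their inverses, together with x (+)_p y <= max(x, y) at the points
   forming a one-element block. *)
Require Import Defs.
From mathcomp Require Import all_boot all_order all_algebra.
From mathcomp Require Import all_classical all_reals all_analysis.
From mathcomp Require Import ring lra.
Import Order.TTheory GRing.Theory Num.Theory.
Import numFieldNormedType.Exports.
Local Open Scope classical_set_scope.
Local Open Scope ring_scope.

(** * Bounds on upper and lower limits along a filter *)

Section limits.
Context {R : realType} {F : set_system R} {FF : Filter F}.
Implicit Types (f : R -> R) (l : R).

(** The upper limit is an infimum of suprema over members of [F], and the set where [f x <= l + e]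
    is one such member. *)
Lemma limf_esup_le f l :
  (forall e, 0 < e -> \forall x \near F, f x <= l + e) ->
  (limf_esup (fun x => (f x)%:E) F <= l%:E)%E.
Proof.
move=> fl; apply/lee_addgt0Pr => e e0; rewrite limf_esupE.
apply: ge_ereal_inf.
exists (ereal_sup [set (f x)%:E | x in [set x | f x <= l + e]]).
  by exists [set x | f x <= l + e] => //; exact: fl.
by apply: ge_ereal_sup => _ [x /= fx <-]; rewrite lee_fin.
Qed.

Lemma cvg_limf_esup_le f l :
  f x @[x --> F] --> l -> (limf_esup (fun x => (f x)%:E) F <= l%:E)%E.
Proof.
move=> fl; apply: limf_esup_le => e e0; move/cvgrPdist_le: fl => /(_ e e0).
by apply: filterS => x; rewrite ler_distlC => /andP[].
Qed.

Lemma cvg_limf_einf_ge f l :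
  f x @[x --> F] --> l -> (l%:E <= limf_einf (fun x => (f x)%:E) F)%E.
Proof.
move=> fl; rewrite /limf_einf leeNr.
have : - f x @[x --> F] --> - l by exact: cvgN.
exact: cvg_limf_esup_le.
Qed.

End limits.

Section plonka_sum.
Variables (R : realType) (E : set R).
Hypotheses (E_sub : E `<=` `[0, 1]) (E_closed : closed E) (E_0 : E 0).
Implicit Types (a e x y : R).

(** * Blocks cut out by [E] and their end points *)

Definition base x : R := sup (E `&` [set y | y <= x]).

(* The default [1] is the right end of the last block when [1] is not in [E]. *)
Definition next a : R := inf (1 |` (E `&` [set y | a < y])).

Lemma base_ge e x : E e -> e <= x -> e <= base x.
Proof.
move=> Ee ex; apply: ub_le_sup; last by split.
by exists x => y [].
Qed.

Lemma base_le x : 0 <= x -> base x <= x.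
Proof. by move=> x0; apply: ge_sup => [|y []//]; exists 0. Qed.

(** The supremum is adherent to a nonempty part of [E] (it contains 0), so closedness keeps it in
    [E]. *)
Lemma base_in x : 0 <= x -> E (base x).
Proof.
move=> x0; apply/E_closed.
apply: (closure_subset (@subIsetl _ E [set y | y <= x])).
apply: closure_sup; first by exists 0.
by exists x => y [].
Qed.

Lemma E_ge0 e : E e -> 0 <= e.
Proof. by move=> /E_sub /=; rewrite in_itv /= => /andP[]. Qed.

Lemma E_le1 e : E e -> e <= 1.
Proof. by move=> /E_sub /=; rewrite in_itv /= => /andP[]. Qed.

Lemma base_ge0 x : 0 <= x -> 0 <= base x.
Proof. by move=> x0; exact: base_ge. Qed.

Lemma le_base x y : 0 <= x -> x <= y -> base x <= base y.
Proof.
move=> x0 xy; apply: base_ge; first exact: base_in.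
exact: le_trans (base_le x x0) xy.
Qed.

Lemma base_id e : E e -> base e = e.
Proof.
by move=> Ee; apply/eqP; rewrite eq_le base_le ?base_ge ?E_ge0.
Qed.

Lemma baseP x : 0 <= x -> base x = x -> E x.
Proof. by move=> x0 <-; exact: base_in. Qed.

Lemma has_inf_next a : has_inf (1 |` (E `&` [set y | a < y])).
Proof.
split; first by exists 1; left.
by exists 0 => y [->|[/E_ge0]].
Qed.

Lemma next_le a e : E e -> a < e -> next a <= e.
Proof. by move=> Ee ae; apply: ge_inf; [case: (has_inf_next a)|right]. Qed.

Lemma le_next a : a <= 1 -> a <= next a.
Proof.
move=> a1; apply: lb_le_inf; first by case: (has_inf_next a).
by move=> y [->//|[_ /ltW]].
Qed.

Lemma next_in a : next a < 1 -> E (next a).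
Proof.
move=> n1; apply/E_closed => B /nbhs_ballP[d /= d0 dB].
(* The bound [1 - next a] forces the approximating point below 1, so that it comes from [E] and is
   not the default 1. *)
have m0 : 0 < Num.min d (1 - next a) by rewrite lt_min d0 subr_gt0.
have [y Sy] := inf_adherent m0 (has_inf_next a).
rewrite -/(next a) -ltrBlDl lt_min => /andP[yd y1].
have ny : next a <= y by apply: ge_inf => //; case: (has_inf_next a).
case: Sy => [yE|[Ey _]]; first by move: y1; rewrite yE ltxx.
exists y; split=> //; apply: dB.
by rewrite /ball /= distrC ger0_norm // subr_ge0.
Qed.

Lemma base_eq a x : E a -> a <= x -> x < next a -> base x = a.
Proof.
move=> Ea ax xn; have x0 : 0 <= x by exact: le_trans (E_ge0 _ Ea) ax.
apply/eqP; rewrite eq_le base_ge // andbT leNgt; apply/negP => ab.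
have := next_le _ _ (base_in x x0) ab.
by rewrite leNgt (le_lt_trans (base_le x x0) xn).
Qed.

Lemma le_next_base x : 0 <= x -> x <= 1 -> x <= next (base x).
Proof.
move=> x0 x1; apply: lb_le_inf; first by case: (has_inf_next (base x)).
move=> y [->//|[Ey /= by_]]; rewrite leNgt; apply/negP => yx.
by have := base_ge y x Ey (ltW yx); rewrite leNgt by_.
Qed.

Lemma base_between a x y z : 0 <= x -> base x = a -> base y = a ->
  x <= z -> z <= y -> base z = a.
Proof.
move=> x0 xa ya xz zy; apply/eqP; rewrite eq_le.
by rewrite -{1}ya -xa !le_base // (le_trans x0).
Qed.

(** Were x equal to [next (base x)], a point of [E], it would be its own base. Without
    [E (next (base x))] the block may contain its right end 1. *)
Lemma lt_next_base x : 0 <= x -> x <= 1 -> base x < next (base x) ->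
  E (next (base x)) -> x < next (base x).
Proof.
move=> x0 x1 bn En; rewrite lt_neqAle le_next_base // andbT.
apply/eqP => xn; move: (bn).
by rewrite -{1}(base_id _ En) -xn ltxx.
Qed.

Lemma base_max A x : E A -> 0 <= x -> base x <= A -> base (Num.max x A) = A.
Proof.
move=> EA x0 xA; case: leP => [_|Ax]; first exact: base_id.
by apply/eqP; rewrite eq_le xA base_ge // ltW.
Qed.

Lemma gap_next a b : gaps E (a, b) -> next a = b.
Proof.
case=> /= Ea Eb ab /disjoints_subset/= abE.
apply/eqP; rewrite eq_le next_le //=.
apply: lb_le_inf; first by case: (has_inf_next a).
move=> y [->|[Ey /= ay]]; first exact: E_le1.
rewrite leNgt; apply/negP => yb; apply: (abE y) => //=.
by rewrite in_itv /= ay yb.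
Qed.

(** * Coordinates on the blocks and the operation *)

Variable k : R -> bool.
(** The coordinate onto [0, +oo) has a pole at [next a], which must therefore lie outside the block
    of a. *)
Hypothesis k_next : forall a, k a -> E (next a).

(* Both are the constant [0], resp. [a], when [next a = a].  Otherwise [k a]
   selects the coordinate [(x - a) / (next a - x)], onto [0, +oo), rather than
   [(x - a) / (next a - a)]. *)
Definition coord a x : R := (x - a) / (next a - a - (k a)%:R * (x - a)).

Definition decode a (t : R) : R := a + t * (next a - a) / (1 + (k a)%:R * t).

(** [A] is the zero of the higher block; [Num.max x A] fixes the points of that block and sends
    those of lower blocks to [A], whose coordinate is 0. *)
Definition op (p x y : R) : R :=
  let A := Num.max (base x) (base y) in
  decode A (p * coord A (Num.max x A) + (1 - p) * coord A (Num.max y A)).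

Lemma coord_den_gt0 x : 0 <= x -> x <= 1 -> base x < next (base x) ->
  0 < next (base x) - base x - (k (base x))%:R * (x - base x).
Proof.
move=> x0 x1 bn; case: (boolP (k (base x))) => /= [/k_next En|_]; last by lra.
by have := lt_next_base x x0 x1 bn En; lra.
Qed.

Lemma decode_den_gt0 a (t : R) : 0 <= t -> 0 < 1 + (k a)%:R * t.
Proof. by move=> t0; case: (k a) => /=; lra. Qed.

Lemma coord_base a : coord a a = 0.
Proof. by rewrite /coord subrr mul0r. Qed.

Lemma decode0 a : decode a 0 = a.
Proof. by rewrite /decode !mul0r addr0. Qed.

Lemma next_le_base x : 0 <= x -> x <= 1 -> next (base x) <= base x ->
  base x = x.
Proof.
move=> x0 x1 nb; apply/eqP.
by rewrite eq_le base_le //= (le_trans (le_next_base x x0 x1)).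
Qed.

Lemma coord_ge0 x : 0 <= x -> x <= 1 -> 0 <= coord (base x) x.
Proof.
move=> x0 x1.
have [bn|nb] := ltP (base x) (next (base x)).
  apply: divr_ge0; last exact/ltW/coord_den_gt0.
  by rewrite subr_ge0 base_le.
by rewrite next_le_base // coord_base.
Qed.

Lemma coordK x : 0 <= x -> x <= 1 -> decode (base x) (coord (base x) x) = x.
Proof.
move=> x0 x1; have [bn|nb] := ltP (base x) (next (base x)); last first.
  by rewrite next_le_base // coord_base decode0.
have d0 := coord_den_gt0 x x0 x1 bn.
rewrite /decode /coord; move: d0 bn.
move: (base x) => b; move: (next b) (k b)%:R => n c d0 bn.
by field; rewrite lt0r_neq0 //= subrK subr_eq0 gt_eqF.
Qed.

Lemma decodeK a (t : R) : a < next a -> 0 <= t -> coord a (decode a t) = t.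
Proof.
move=> an t0; have := decode_den_gt0 a t t0; rewrite /decode /coord.
move: (next a) an => n an d0.
have d1 : n - a != 0 by apply: lt0r_neq0; lra.
case: (k a) d0 => /= d0; field => //.
by apply/andP; split; apply: lt0r_neq0; lra.
Qed.

Lemma le_decode a (s t : R) : a <= 1 -> 0 <= s -> s <= t ->
  decode a s <= decode a t.
Proof.
move=> a1 s0 st; have an := le_next a a1; have t0 := le_trans s0 st.
rewrite /decode lerD2l ler_pdivrMr ?decode_den_gt0 // mulrAC.
rewrite ler_pdivlMr ?decode_den_gt0 //; case: (k a); nra.
Qed.

(** The mixture lies between the two coordinates, so by monotonicity its decoding lies between u and
    v; blocks are order-convex, hence it stays in the block. *)
Lemma base_decode_mix (A p u v : R) (c := p * coord A u + (1 - p) * coord A v) :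
  0 < p < 1 -> 0 <= u <= 1 -> 0 <= v <= 1 -> base u = A -> base v = A ->
  [/\ 0 <= decode A c <= 1, base (decode A c) = A & coord A (decode A c) = c].
Proof.
move=> /andP[p0 p1] /andP[u0 u1] /andP[v0 v1] uA vA.
have A1 : A <= 1 by rewrite -uA (le_trans (base_le _ u0)).
have s0 : 0 <= coord A u by rewrite -uA coord_ge0.
have t0 : 0 <= coord A v by rewrite -vA coord_ge0.
have su : decode A (coord A u) = u by rewrite -{1 2}uA coordK.
have tv : decode A (coord A v) = v by rewrite -{1 2}vA coordK.
have c0 : 0 <= c by rewrite /c; nra.
have [z01 zA] : 0 <= decode A c <= 1 /\ base (decode A c) = A.
  have [st|/ltW st] := leP (coord A u) (coord A v).
    have uz : u <= decode A c by rewrite -{1}su le_decode // /c; nra.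
    have zv : decode A c <= v by rewrite -{1}tv le_decode // /c; nra.
    by rewrite (le_trans u0 uz) (le_trans zv v1) (base_between A u v).
  have uz : v <= decode A c by rewrite -{1}tv le_decode // /c; nra.
  have zv : decode A c <= u by rewrite -{1}su le_decode // /c; nra.
  by rewrite (le_trans v0 uz) (le_trans zv u1) (base_between A v u).
split=> //; have [An|nA] := ltP A (next A); first exact: decodeK.
(* In a one-element block [decodeK] does not apply, but all coordinates vanish. *)
have uE : u = A by rewrite -uA next_le_base // uA.
have vE : v = A by rewrite -vA next_le_base // vA.
by rewrite /c uE vE coord_base !mulr0 addr0 decode0 coord_base.
Qed.

(** * The convex algebra axioms *)

Lemma max01 (x A : R) : E A -> 0 <= x <= 1 -> 0 <= Num.max x A <= 1.
Proof.
move=> EA /andP[x0 x1].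
by rewrite le_max x0 /= ge_max x1 E_le1.
Qed.

Lemma E_max_base (x y : R) : 0 <= x -> 0 <= y -> E (Num.max (base x) (base y)).
Proof. by move=> x0 y0; case: leP => _; exact: base_in. Qed.

Lemma op_spec (p x y : R) (A := Num.max (base x) (base y)) :
  0 < p < 1 -> 0 <= x <= 1 -> 0 <= y <= 1 ->
  [/\ 0 <= op p x y <= 1, base (op p x y) = A &
  coord A (op p x y) =
    p * coord A (Num.max x A) + (1 - p) * coord A (Num.max y A)].
Proof.
move=> p01 x01 y01; have /andP[x0 _] := x01; have /andP[y0 _] := y01.
have EA : E A by exact: E_max_base.
by apply: base_decode_mix; rewrite ?max01 ?base_max ?le_max ?lexx ?orbT.
Qed.

Lemma op01 (p x y : R) : 0 < p < 1 -> 0 <= x <= 1 -> 0 <= y <= 1 ->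
  0 <= op p x y <= 1.
Proof. by move=> p01 x01 y01; case: (op_spec p x y). Qed.

Lemma base_op (p x y : R) : 0 < p < 1 -> 0 <= x <= 1 -> 0 <= y <= 1 ->
  base (op p x y) = Num.max (base x) (base y).
Proof. by move=> p01 x01 y01; case: (op_spec p x y). Qed.

Lemma base_lt (A x : R) : E A -> base x < A -> x < A.
Proof. by move=> EA; rewrite !ltNge; apply: contra; exact: base_ge. Qed.

(* [x |-> coord A (max x A)] is the homomorphism to the block of [A] that
   collapses all lower blocks to the zero [A] of that block. *)
Lemma coord_max_op (A p x y : R) : E A -> 0 < p < 1 ->
  0 <= x <= 1 -> 0 <= y <= 1 -> base x <= A -> base y <= A ->
  coord A (Num.max (op p x y) A) =
    p * coord A (Num.max x A) + (1 - p) * coord A (Num.max y A).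
Proof.
move=> EA p01 x01 y01 xA yA; have [z01 bz cz] := op_spec p x y p01 x01 y01.
have : base (op p x y) <= A by rewrite bz ge_max xA.
rewrite le_eqVlt => /orP[/eqP zA|zA].
  have z0 : 0 <= op p x y by case/andP: z01.
  have -> : Num.max (op p x y) A = op p x y.
    by apply/max_idPl; rewrite -{1}zA base_le.
  by rewrite -zA bz.
have /andP[xA' yA'] : (base x < A) && (base y < A) by rewrite -gt_max -bz.
rewrite !max_r ?coord_base; first by rewrite !mulr0 addr0.
all: by apply/ltW/base_lt.
Qed.

Lemma coord_max_inj (x y : R) : 0 <= x <= 1 -> 0 <= y <= 1 ->
  base x = base y ->
  coord (base x) (Num.max x (base x)) = coord (base x) (Num.max y (base x)) ->
  x = y.
Proof.
move=> /andP[x0 x1] /andP[y0 y1] xy.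
rewrite max_l ?base_le // max_l ?xy ?base_le // => cxy.
by rewrite -(coordK x x0 x1) -(coordK y y0 y1) xy cxy.
Qed.

Lemma op_convex_algebra : convex_algebra `[0, 1] op.
Proof.
split=> [p x y|p x|p x y|p q x y z] p01.
- by rewrite /= !in_itv /=; exact: op01.
- rewrite /= in_itv /= => x01; have /andP[x0 x1] := x01.
  rewrite /op maxxx max_l ?base_le // -mulrDl addrC subrK mul1r.
  by rewrite coordK.
- by rewrite /op maxC /= => _ _; rewrite subKr addrC.
- move=> q01; rewrite /= !in_itv /= => x01 y01 z01.
  have r01 : 0 < (1 - p) * q / (1 - p * q) < 1.
    have pq : 0 < 1 - p * q by nra.
    by rewrite divr_gt0 ?mulr_gt0 /= ?ltr_pdivrMr //; nra.
  have pq01 : 0 < p * q < 1 by nra.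
  have xy01 := op01 p x y p01 x01 y01; have yz01 := op01 _ y z r01 y01 z01.
  (* Both sides lie in the same block since max is associative; there it suffices to compare
     coordinates, which the collapsing homomorphism reduces to a real identity. *)
  have bb : base (op q (op p x y) z) =
      base (op (p * q) x (op ((1 - p) * q / (1 - p * q)) y z)).
    by rewrite !base_op // maxA.
  apply: coord_max_inj; rewrite ?op01 //.
  set A := base _.
  have EA : E A by apply: base_in; case/andP: (op01 q _ z q01 xy01 z01).
  have [xA yA zA] : [/\ base x <= A, base y <= A & base z <= A].
    by split; rewrite /A !base_op // !le_max lexx ?orbT.
  rewrite !coord_max_op ?base_op ?ge_max ?xA ?yA ?zA //.
  by field; rewrite lt0r_neq0 // subr_gt0; case/andP: pq01.
Qed.

(** * Monotonicity of the operation *)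

(** Follows from monotonicity of the inverse [decode]: a reversed inequality of coordinates would
    give y <= x, hence x = y. *)
Lemma le_coord (x y : R) : 0 <= x -> x <= y -> y <= 1 -> base x = base y ->
  coord (base x) x <= coord (base x) y.
Proof.
move=> x0 xy y1 bxy; have y0 := le_trans x0 xy; have x1 := le_trans xy y1.
rewrite leNgt; apply/negP => cyx.
have yx : y <= x.
  rewrite -[leLHS]coordK // -[leRHS]coordK // -bxy; apply: le_decode.
  - exact/E_le1/base_in.
  - by rewrite bxy coord_ge0.
  - exact: ltW.
by move: cyx; have /eqP -> : x == y; rewrite ?ltxx // eq_le xy yx.
Qed.

Lemma op_MO : MO op.
Proof.
move=> x x' y p /=; rewrite !in_itv /= => x01 x'01 y01 p01 xx'.
have bb : base (op p x y) <= base (op p x' y).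
  case/andP: x01 => x0 x1; rewrite !base_op ?x0 //.
  by rewrite ge_max !le_max lexx le_base // orbT.
(* If the results lie in different blocks, the zero of the higher block separates them. Otherwise
   both are computed in the block of one [A]. *)
move: bb; rewrite le_eqVlt => /orP[/eqP bb|bb]; last first.
  have /andP[w0 _] := op01 p x' y p01 x'01 y01.
  have := base_lt _ _ (base_in _ w0) bb.
  by move=> /ltW/le_trans; apply; exact: base_le.
have /andP[x0 x1] := x01; have /andP[x'0 x'1] := x'01; have /andP[y0 _] := y01.
move: bb; rewrite !base_op // /op => bb; rewrite -bb; set A := Num.max _ _.
have EA : E A by exact: E_max_base.
have x'A : base x' <= A by rewrite /A bb le_max lexx.
have [xA yA] : base x <= A /\ base y <= A by rewrite /A !le_max !lexx orbT.
clearbody A; have coord_max_ge0 z : 0 <= z <= 1 -> base z <= A ->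
    0 <= coord A (Num.max z A).
  move=> z01 zA; have /andP[m0 m1] := max01 z A EA z01.
  by rewrite -{1}[A](base_max A z) ?coord_ge0 //; case/andP: z01.
case/andP: p01 => p0 p1; apply: le_decode.
- exact: E_le1.
- by rewrite addr_ge0 // mulr_ge0 ?coord_max_ge0 // ?ltW // subr_gt0.
rewrite lerD2r ler_pM2l // -{1 3}[A](base_max A x) //; apply: le_coord.
- by rewrite le_max x0.
- by rewrite ge_max !le_max xx' lexx orbT.
- by rewrite ge_max x'1 E_le1.
- by rewrite !base_max.
Qed.

(** Raise both arguments to the maximum m by (MO), using commutativity for the second one, and
    conclude by idempotence. *)
Lemma op_le_max (p x y : R) : 0 < p < 1 -> 0 <= x <= 1 -> 0 <= y <= 1 ->
  op p x y <= Num.max x y.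
Proof.
move=> p01 x01 y01; set m := Num.max x y.
have m01 : 0 <= m <= 1 by rewrite /m; case: (leP x y).
have [_ op_idem op_comm _] := op_convex_algebra.
have I (z : R) : 0 <= z <= 1 -> `[0, 1]%classic z by rewrite /= in_itv.
have p'01 : 0 < 1 - p < 1 by lra.
apply: (@le_trans _ _ (op p m y)).
  by apply: op_MO; rewrite ?in_itv //= /m le_max lexx.
rewrite op_comm; [|by []|exact: I|exact: I].
rewrite -[leRHS](op_idem (1 - p)); [|by []|exact: I].
by apply: op_MO; rewrite ?in_itv //= /m le_max lexx orbT.
Qed.

(** * Continuity, (LC) and (UC) *)

Lemma coord_continuous (a x : R) : next a - a - (k a)%:R * (x - a) != 0 ->
  {for x, continuous (coord a)}.
Proof.
move=> d0; rewrite /prop_for /continuous_at /coord.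
apply: cvgM; first by apply: cvgB; [exact: cvg_id|exact: cvg_cst].
apply: cvgV => //; apply: cvgB; first exact: cvg_cst.
by apply: cvgM; [exact: cvg_cst|apply: cvgB; [exact: cvg_id|exact: cvg_cst]].
Qed.

Lemma decode_continuous (a t : R) : 0 <= t -> {for t, continuous (decode a)}.
Proof.
move=> t0; have d0 := decode_den_gt0 a t t0.
rewrite /prop_for /continuous_at /decode.
apply: cvgD; first exact: cvg_cst.
apply: cvgM; first by apply: cvgM; [exact: cvg_id|exact: cvg_cst].
apply: cvgV; first exact: lt0r_neq0.
apply: cvgD; first exact: cvg_cst.
by apply: cvgM; [exact: cvg_cst|exact: cvg_id].
Qed.

Lemma op_LC : LC op.
Proof.
move=> x y /=; rewrite !in_itv /= => /andP[x0 x1] /andP[y0 y1] xy.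
apply: cvg_limf_einf_ge; rewrite /op max_l ?le_base // max_l ?base_le //.
rewrite -[X in _ --> X](coordK y) //.
apply: (@cvg_comp _ _ _ _ (decode (base y))); last first.
  by apply: decode_continuous; exact: coord_ge0.
set u := coord _ y; set v := coord _ _.
(* As x <= y, the result stays in the block of y; its coordinate is affine in p and takes the value
   u at p = 1. *)
have -> : nbhs u = nbhs (1 * u + (1 - 1) * v).
  by rewrite mul1r subrr mul0r addr0.
apply: cvg_at_left_filter; apply: cvgD.
  by apply: cvgM; [exact: cvg_id|exact: cvg_cst].
apply: cvgM; last exact: cvg_cst.
by apply: cvgB; [exact: cvg_cst|exact: cvg_id].
Qed.

Lemma base_maxE (x y : R) : 0 <= x -> 0 <= y ->
  base (Num.max x y) = Num.max (base x) (base y).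
Proof.
move=> x0 y0; have [xy|/ltW yx] := leP x y.
  by rewrite max_r // le_base.
by rewrite max_l // le_base.
Qed.

Lemma op_UC : UC op.
Proof.
move=> x y p /=; rewrite !in_itv /= => /andP[x0 x1] /andP[y0 y1] p01.
have x01 : 0 <= x <= 1 by rewrite x0 ltW.
have y01 : 0 <= y <= 1 by rewrite y0 ltW.
set m := Num.max x y; set A := base m.
have m1 : m < 1 by rewrite /m gt_max x1.
have m0 : 0 <= m by rewrite /m le_max x0.
have maxA : Num.max (base x) (base y) = A by rewrite /A base_maxE.
(* In a one-element block [A] is m itself, so [op p x y] is at least m, while the shifted results
   are at most m + e. *)
have [An|nA] := ltP A (next A); last first.
  have mE : A = m by apply: next_le_base => //; exact: ltW.
  have mop : m <= op p x y.
    rewrite -mE -maxA -(base_op p) // base_le //.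
    by case/andP: (op01 p x y p01 x01 y01).
  apply: limf_esup_le => d d0; near=> e.
  have e0 : 0 < e by near: e; exact: nbhs_right_gt.
  have ed : e <= d by near: e; exact: nbhs_right_le.
  have e1 : e < 1 - m by near: e; apply: nbhs_right_lt; rewrite subr_gt0.
  apply: (@le_trans _ _ (m + e)); last by lra.
  rewrite /m addr_maxl; move: e1; rewrite ltrBrDl /m addr_maxl gt_max.
  move=> /andP[? ?]; apply: op_le_max => //; lra.
have mn : m < next A.
  (* [next A] is in [E] unless it is at least 1, and then m < 1 suffices. *)
  have [n1|n1] := ltP (next A) 1; last exact: lt_le_trans m1 n1.
  by apply: lt_next_base => //; [exact: ltW|exact: next_in].
have mA z : 0 <= z <= m ->
    {for 0, continuous (fun e => coord A (Num.max (z + e) A))}.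
  move=> /andP[z0 zm].
  apply: (@continuous_comp _ _ _ (fun e => Num.max (z + e) A) (coord A)).
    apply: continuous_max; last exact: cvg_cst.
    by apply: cvgD; [exact: cvg_cst|exact: cvg_id].
  have bz : base z <= A by exact: le_base.
  have EA : E A by exact: base_in.
  apply: coord_continuous; rewrite addr0.
  have := coord_den_gt0 (Num.max z A); rewrite base_max // => /(_ _ _ An) H.
  apply/lt0r_neq0/H; first by rewrite le_max z0.
  by rewrite ge_max (E_le1 A) // andbT; lra.
apply: cvg_limf_esup_le.
(* For small e > 0 the point m + e stays in the block of [A], so the shifted operation equals [G e],
   with [A] frozen and [G] continuous at 0. *)
pose G e := decode A (p * coord A (Num.max (x + e) A) +
                      (1 - p) * coord A (Num.max (y + e) A)).
have GC : {for 0, continuous G}.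
  apply: (@continuous_comp _ _ _ (fun e => p * coord A (Num.max (x + e) A) +
                      (1 - p) * coord A (Num.max (y + e) A)) (decode A)).
    apply: cvgD; (apply: cvgM; first exact: cvg_cst).
      by apply: mA; rewrite x0 /m le_max lexx.
    by apply: mA; rewrite y0 /m le_max lexx orbT.
  apply: decode_continuous; rewrite !addr0.
  have [w01 bw] := op_spec p x y p01 x01 y01.
  rewrite maxA => <-; rewrite -maxA -bw.
  by case/andP: w01 => *; exact: coord_ge0.
have -> : op p x y = G 0 by rewrite /op /G !addr0 maxA.
apply: cvg_trans (cvg_at_right_filter GC); apply: near_eq_cvg; near=> e.
have e0 : 0 < e by near: e; exact: nbhs_right_gt.
have e1 : e < next A - m by near: e; apply: nbhs_right_lt; rewrite subr_gt0.
rewrite /op -base_maxE; [|lra|lra].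
rewrite -addr_maxl (base_eq A) //.
- exact: base_in.
- by rewrite (le_trans (base_le m m0)) // lerDl ltW.
- by rewrite -/m; lra.
Unshelve. all: by end_near. Qed.

(** * The set [Eset op] and the types of the gaps *)

Lemma Eset_op : Eset op = E.
Proof.
rewrite /Eset /dominates; apply/seteqP; split=> y /=; last first.
  move=> Ey; split=> [|t t01]; first exact: E_sub.
  rewrite /op (base_id 0) // base_id // max_l ?E_ge0 // maxxx max_r ?E_ge0 //.
  by rewrite coord_base !mulr0 addr0 decode0.
(* Mixing y with 0 at weight 1/2 halves the coordinate of y. If y is unchanged, this coordinate is
   0, so y is its own base. *)
rewrite in_itv /= => -[/andP[y0 y1]] /(_ 2^-1) yE.
have h01 : 0 < (2^-1 : R) < 1 by lra.
apply: baseP => //; have Ey := base_in y y0.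
have := coord_max_op (base y) 2^-1 y 0 Ey h01.
rewrite y0 y1 !lexx ler01 (base_id 0) // base_ge0 // yE //.
rewrite max_l ?base_le // max_r ?base_ge0 // coord_base mulr0 addr0.
move=> /(_ isT isT isT isT) c0; have {}c0 : coord (base y) y = 0 by lra.
by rewrite -[RHS]coordK // c0 decode0.
Qed.

Lemma base_gap (a b x : R) : gaps E (a, b) ->
  `[a, b[%classic x <-> 0 <= x <= 1 /\ base x = a.
Proof.
move=> gab; have [/= Ea Eb ab _] := gab; have nb := gap_next a b gab.
have [a0 b1] := (E_ge0 a Ea, E_le1 b Eb).
rewrite /= in_itv /=; split=> [/andP[ax xb]|[/andP[x0 x1] xa]].
  split; first by apply/andP; split; lra.
  by apply: base_eq => //; rewrite nb.
rewrite -{1}xa base_le //= -nb -xa lt_next_base // xa nb //.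
Qed.

(** The isomorphism is [coord a], with inverse [decode a]; it is affine by [op_spec], and [k a]
    selects its range. *)
Lemma op_gap (a b : R) : gaps E (a, b) ->
  tau_candidate op a b (if k a then +oo%E else 1%E).
Proof.
move=> gab; have [/= Ea Eb ab _] := gab; have nb := gap_next a b gab.
have [a0 b1] := (E_ge0 a Ea, E_le1 b Eb).
split; first by case: (k a); [right|left].
split.
  split=> [x /(base_gap a b x gab)[]|p x y p01]; first by rewrite /= in_itv.
  move=> /(base_gap a b x gab)[x01 xa] /(base_gap a b y gab)[y01 ya].
  by apply/(base_gap a b _ gab); rewrite op01 // base_op // xa ya maxxx.
exists (coord a); split; last first.
  move=> p x y p01 /(base_gap a b x gab)[x01 xa] /(base_gap a b y gab)[y01 ya].
  have [_ _] := op_spec p x y p01 x01 y01; rewrite xa ya maxxx => ->.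
  have /andP[x0 _] := x01; have /andP[y0 _] := y01.
  by rewrite max_l -1?xa ?base_le // max_l // xa -ya base_le.
split=> [x|x y|t].
- move=> xab; have /(base_gap a b x gab)[/andP[x0 x1] xa] := xab.
  split; first by rewrite -xa coord_ge0.
  have := coord_den_gt0 x x0 x1; rewrite xa nb => /(_ ab) d0.
  move: xab d0; rewrite /coord nb /= in_itv /= => /andP[ax xb].
  case: (k a) => /= d0; first exact: ltry.
  by rewrite lte_fin ltr_pdivrMr //; lra.
- rewrite !inE => /(base_gap a b x gab)[/andP[x0 x1] xa].
  move=> /(base_gap a b y gab)[/andP[y0 y1] ya] cxy.
  by rewrite -(coordK x) // -(coordK y) // xa ya cxy.
- move=> [/= t0 t1]; exists (decode a t); last by apply: decodeK; rewrite ?nb.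
  rewrite /= in_itv /=; apply/andP; split.
    by rewrite -{1}[a]decode0 le_decode //; lra.
  have d0 := decode_den_gt0 a t t0.
  rewrite /decode nb -ltrBrDl ltr_pdivrMr //.
  by case: (k a) t1 => /=; rewrite ?lte_fin; nra.
Qed.

End plonka_sum.

(* An affine map h >= 0 on [0, 1) is bounded: for every s the point 1/2 is
   s/3 + 2s'/3 with s' = 3/4 - s/2 in [0, 1), so h s <= 3 h (1/2). *)
Lemma ico0_1_not_iso_y (R : realType) (X : set R) (op : R -> R -> R -> R) :
  conv_closed X op -> conv_isomorphic X op (ico0 1) (@real_conv R) ->
  ~ conv_isomorphic X op (ico0 +oo) (@real_conv R).
Proof.
move=> Xop [f [[fX finj fsurj] fop]] [g [[gX ginj gsurj] gop]].
have t01 : 0 < (3^-1 : R) < 1 by lra.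
have I1 (t : R) : 0 <= t < 1 -> ico0 1 t by move=> /andP[].
have [x Xx fx] : exists2 x, X x & f x = 2^-1.
  by have [|x] := fsurj 2^-1; [apply: I1; lra|exists x].
have [gx0 _] := gX _ Xx.
(* For h the composite of g with the inverse of f, [g x] is h (1/2); z is chosen to exceed the bound
   3 h (1/2). *)
have [z Xz gz] : exists2 z, X z & g z = 3 * g x + 1.
  have [|z] := gsurj (3 * g x + 1); last by exists z.
  by split; [lra|exact: ltry].
have [fz0] := fX _ Xz; rewrite lte_fin => fz1.
have [w Xw fw] : exists2 w, X w & f w = 3 / 4 - f z / 2.
  by have [|w] := fsurj (3 / 4 - f z / 2); [apply: I1; lra|exists w].
have [gw0 _] := gX _ Xw.
have xE : op 3^-1 z w = x.
  apply: finj; rewrite ?inE //; first exact: Xop.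
  by rewrite fop // fx fw /real_conv; lra.
by have := gop _ _ _ t01 Xz Xw; rewrite xE gz /real_conv; lra.
Qed.

Theorem theorem4p1 (R : realType) (E : set R)
  (E_sub : E `<=` `[0, 1]%classic) (E_closed : closed E) (E_0 : E 0)
  (sigma : R -> R -> \bar R)
  (sigma_val : forall a b : R, gaps E (a, b) ->
     sigma a b = 1%E \/ sigma a b = +oo%E) :
  exists op : R -> R -> R -> R,
    [/\ convex_algebra (`[0, 1]%classic : set R) op,
        [/\ MO op, UC op & LC op],
        Eset op = E,
        gaps (Eset op) = gaps E &
        forall a b : R, gaps E (a, b) -> is_tau op a b (sigma a b)].
Proof.
(* [sigma] is arbitrary off the gaps, so the conjunct [E (next R E a)] is what secures [k_next]. *)
pose k a := `[< E (next R E a) /\ sigma a (next R E a) = +oo%E >].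
have k_next a : k a -> E (next R E a) by move=> /asboolP[].
exists (op R E k); split.
- by apply: op_convex_algebra.
- by split; [exact: op_MO|exact: op_UC|exact: op_LC].
- exact: Eset_op.
- by rewrite Eset_op.
move=> a b gab; have := op_gap _ _ E_sub E_closed E_0 k k_next a b gab.
have nb : next R E a = b by exact: gap_next.
have -> : (if k a then +oo%E else 1%E) = sigma a b.
  have [_ Eb _ _] := gab.
  rewrite /k nb; case: asboolP => [[_ ->]//|kN].
  by case: (sigma_val a b gab) => // sab; case: kN.
(* A second candidate would make the same block isomorphic to both [0, 1) and [0, +oo). *)
move=> tau; split=> // t [t1y [[_ cl] iso]].
have [sab [_ iso']] := tau.
case: sab t1y iso iso' => -> [] -> // iso iso'; exfalso.
  exact: ico0_1_not_iso_y cl iso' iso.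
exact: ico0_1_not_iso_y cl iso iso'.
Qed.
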